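(* Let $\mathcal{C} \subset \mathbb{R}$ be the set of all real numbers $x$ for which there exist a group $G$ and a finite generating subset $S$ of $G$ such that $x = \mu(\mathrm{Cay}(G,S))$, where $\mu$ denotes the connective constant. Then $\mathcal{C}$ contains a Cantor space, i.e. there is a subset $K \subset \mathcal{C}$ which, endowed with the topology induced from $\mathbb{R}$, is homeomorphic to $\{0,1\}^{\mathbb{N}}$ with the product topology. In particular, the subset $\mathcal{C}$ of $\mathbb{R}$ has cardinality $2^{\aleph_0}$.
   Context: Graphs are taken to be simple, unoriented, non-empty, connected and locally finite. The set $\mathbb{N}$ contains $0$. Cayley graph: given a group $G$ and a finite generating subset $S$ of $G$, the Cayley graph $\mathrm{Cay}(G,S)$ is the graph with vertex set $G$ in which two distinct elements $g,h \in G$ are connected by an edge if and only if $g^{-1}h \in S \cup S^{-1}$. A graph is transitive if it admits an action by graph automorphisms that is transitive on its set of vertices; Cayley graphs are transitive. Connective constant: given a transitive graph $\mathcal{G}$ and a vertex $o$ of $\mathcal{G}$, let $c_n$ be the number of paths in $\mathcal{G}$ starting at $o$, going through $n$ edges and not visiting any vertex more than once (self-avoiding paths of length $n$ from $o$). By Fekete's Subadditive Lemma, $c_n^{1/n}$ converges as $n \to \infty$ to a real number, which does not depend on the choice of $o$. This limit $\mu(\mathcal{G}) := \lim_{n\to\infty} c_n^{1/n}$ is called the connective constant of $\mathcal{G}$. *)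

(* Defs.v *)
From HB Require Import structures.
From mathcomp Require Import all_boot all_order all_algebra finmap.
From mathcomp Require Import all_classical all_reals all_analysis.

Set Implicit Arguments.
Unset Strict Implicit.
Unset Printing Implicit Defensive.

Import Order.TTheory GRing.Theory Num.Theory.
Import numFieldNormedType.Exports.

Local Open Scope classical_set_scope.
Local Open Scope ring_scope.

(* No proper subgroup of G contains S.  Subgroups are boolean predicates, which
   classically is the same as arbitrary subsets closed under the operations. *)
Definition generating (G : groupType) (S : {fset G}) : Prop :=
  forall H : {pred G}, group_closed H -> {subset S <= H} ->
    forall g : G, g \in H.

Definition cayley_graph (G : groupType) (S : {fset G}) : rel G :=
  fun g h => (g != h) &&
    ((g^-1 * h)%g \in (S `|` [fset s^-1%g | s in S])%fset).

(* A path with n edges from o is given by the sequence of the n vertices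
   visited after o. *)
Definition self_avoiding_paths (V : choiceType) (e : rel V) (o : V) (n : nat) :
    set (seq V) :=
  [set p | [/\ size p = n, path e o p & uniq (o :: p)]].

(* fset_set A enumerates A when A is finite; in a locally finite graph this is
   the case (see finite_self_avoiding_paths for Cayley graphs). *)
Definition saw_count (V : choiceType) (e : rel V) (o : V) (n : nat) : nat :=
  #|` fset_set (self_avoiding_paths e o n)|%fset.

(* The limit is required from every starting vertex, so that no base point has
   to be chosen; in a transitive graph c_n does not depend on it.  The term
   n = 0 of the sequence is irrelevant; for n > 0 the power is the n-th root,
   including 0 `^ n^-1 = 0. *)
Definition is_connective_constant (R : realType) (V : choiceType) (e : rel V)
    (mu : R) : Prop :=
  forall o : V,
    (saw_count e o n)%:R `^ n%:R^-1 @[n --> \oo] --> mu.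

Definition cayley_connective_constants (R : realType) : set R :=
  [set x | exists (G : groupType) (S : {fset G}),
     generating S /\ is_connective_constant (cayley_graph S) x].
Arguments cayley_connective_constants R : clear implicits.

Definition homeomorphic (T U : topologicalType) : Prop :=
  exists (f : T -> U) (g : U -> T),
    [/\ continuous f, continuous g, cancel f g & cancel g f].

Lemma finite_self_avoiding_paths (G : groupType) (S : {fset G}) (o : G)
    (n : nat) :
  finite_set (self_avoiding_paths (cayley_graph S) o n).
Proof.
pose T := (S `|` [fset s^-1%g | s in S])%fset.
suff fin m x : finite_set
    [set p | size p = m /\ path (cayley_graph S) x p].
  by apply: sub_finite_set (fin n o) => p [].
elim: m x => [|m IH] x.
  apply: (@sub_finite_set _ _ [set [::]]) (finite_set1 _).
  by move=> p [/size0nil ->].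
apply: (@sub_finite_set _ _ (\bigcup_(t in [set` T])
    (cons (x * t)%g @` [set p | size p = m /\
       path (cayley_graph S) (x * t)%g p]))).
  case=> [|y p] /= [] // /succn_inj szp /andP[/andP[_ yT] pth].
  have xy : (x * (x^-1 * y))%g = y by rewrite mulgA mulgV mul1g.
  by exists (x^-1 * y)%g => //=; exists p; rewrite ?xy.
apply: bigcup_finite; first exact: finite_fset.
by move=> t _; apply/finite_image/IH.
Qed.

(* Main.v *)
Require Import Defs.
From HB Require Import structures.
From mathcomp Require Import all_boot all_order all_algebra finmap.
From mathcomp Require Import all_classical all_reals all_analysis.
From mathcomp Require Import zify ring lra.

Set Implicit Arguments.
Unset Strict Implicit.
Unset Printing Implicit Defensive.

Import Order.TTheory GRing.Theory Num.Theory.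
Import numFieldNormedType.Exports.

Local Open Scope classical_set_scope.
Local Open Scope card_scope.

(** Let F_A be the free product of Z/2 with the group G_A, where A is a set of
    integers at least 2 and G_A is the group of permutations of nat * int
    generated by the shift x -> x + 1 of every line and by an involution which
    exchanges 0 and 1 on every line and also exchanges j and j + 1 on the line
    number j when j is in A.  The connective constants of the F_A contain a
    Cantor space.

    Self-avoiding walks are handled as words: a word in the generators traces a
    self-avoiding walk if and only if no non-empty factor of it represents the
    identity ([uniq_walk], [saw_count_letters]), so that only the set of words
    representing the identity matters.  Four facts about the connective
    constant mu(A) of F_A are needed.

    - mu(A) exists, as the infimum of the n-th roots of the counts
      ([growth_cvg], Fekete).
    - mu is nondecreasing in A, because enlarging A leaves fewer words
      representing the identity ([connective_le]).
    - mu is upper semicontinuous: a word of length n cannot tell apart the line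
      with a defect at j from the line without one when j is large with respect
      to n ([base_trivial_local]), and mu(A) is an infimum of quantities that
      depend on finitely many words ([connective_usc]).
    - mu(A) < mu(A + {n}) when A is contained in [0, n[ ([connective_lt]).
      There is a word that represents the identity for A but not for A + {n},
      namely the commutator of the involution with its conjugate by the shift of
      n + 1 ([probe_trivial], [probe_nontrivial]); hence some self-avoiding word
      of G_(A + {n}) is not self-avoiding in G_A.  In a free product with Z/2
      the self-avoiding words are the concatenations of self-avoiding words of
      the factor separated by the extra generator, and such a renewal structure
      turns one additional block into an exponential gain ([growth_lt]).

    From these facts one extracts a fast increasing sequence nu_0 < nu_1 < ...
    such that the elements of A from nu_(k + 1) on change mu by less than the gain
    obtained by adding nu_k, and by less than 1 / (nu_k + 1).  Then
    b |-> mu({nu_k | b_k}) is strictly increasing for the lexicographic order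
    and continuous on the Cantor space; by compactness it is a homeomorphism
    onto its range.  The cardinality follows by Cantor-Bernstein. *)

(** * Counting words *)

Section Counting.
Variable B : finType.
Implicit Types (P Q : pred (seq B)) (w u v r : seq B).

Fixpoint count_words Q n : nat :=
  if n is n'.+1 then \sum_(b : B) count_words (fun w => Q (b :: w)) n'
  else Q [::].

Lemma leq_count_words Q Q' n :
  (forall w, size w = n -> Q w -> Q' w) -> count_words Q n <= count_words Q' n.
Proof.
elim: n Q Q' => [|n IH] Q Q' QQ' /=.
  by have := QQ' [::] erefl; case: (Q [::]) => // ->.
by apply: leq_sum => b _; apply: IH => w wn; apply: QQ'; rewrite /= wn.
Qed.

Lemma eq_count_words Q Q' n : Q =1 Q' -> count_words Q n = count_words Q' n.
Proof.
by move=> QQ'; apply/eqP; rewrite eqn_leq !leq_count_words // => w _; rewrite QQ'.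
Qed.

Lemma ltn_count_words Q Q' w : (forall v, Q v -> Q' v) -> Q' w -> ~~ Q w ->
  count_words Q (size w) < count_words Q' (size w).
Proof.
elim: w Q Q' => [|b w IH] Q Q' QQ' /= Q'w nQw.
  by rewrite Q'w (negbTE nQw).
rewrite (bigD1 b) // [ltnRHS](bigD1 b) //= -addSn; apply: leq_add.
  by apply: (IH (fun w => Q (b :: w)) (fun w => Q' (b :: w))) => // v; apply: QQ'.
by apply: leq_sum => c _; apply: leq_count_words => v _; apply: QQ'.
Qed.

Lemma count_words0 n : count_words pred0 n = 0.
Proof. by elim: n => [|n IH] //=; rewrite big1. Qed.

Lemma count_words_andb (c : bool) Q n :
  count_words (fun w => c && Q w) n = c * count_words Q n.
Proof.
case: c; rewrite ?mul1n ?mul0n; first exact: eq_count_words.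
by rewrite -[RHS](count_words0 n); apply: eq_count_words.
Qed.

Lemma count_words_submult Q P P' m n :
  (forall u v, Q (u ++ v) -> P u && P' v) ->
  count_words Q (m + n) <= count_words P m * count_words P' n.
Proof.
elim: m Q P => [|m IH] Q P QP /=.
  rewrite -count_words_andb; apply: leq_count_words => w _ Qw.
  exact: (QP [::] w).
rewrite big_distrl /=; apply: leq_sum => b _; apply: IH => u v.
exact: (QP (b :: u)).
Qed.

Lemma card_count_words Q n :
  #|[set w : n.-tuple B | Q w]%SET| = count_words Q n.
Proof.
elim: n Q => [|n IH] Q /=.
  case Q0: (Q [::]).
    rewrite (_ : [set w | _]%SET = finset.setT) ?cardsT ?card_tuple //.
    by apply/setP => w; rewrite tuple0 !inE Q0.
  rewrite (_ : [set w | _]%SET = finset.set0) ?cards0 //.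
  by apply/setP => w; rewrite tuple0 !inE Q0.
rewrite -sum1_card (partition_big (fun w : n.+1.-tuple B => thead w) xpredT) //=.
apply: eq_bigr => b _; rewrite -IH -sum1_card.
rewrite (reindex (fun w : n.-tuple B => [tuple of b :: w])) /=.
  by apply: eq_bigl => w; rewrite !inE /thead tnth0 eqxx andbT.
exists (fun w : n.+1.-tuple B => [tuple of behead w]) => w.
  by move=> _; apply: val_inj.
by rewrite inE => /andP[_ /eqP <-]; rewrite [RHS]tuple_eta; apply: val_inj.
Qed.
End Counting.

(** Cutting at the first occurrence of the extra letter [None]. *)
Lemma count_words_split (B : finType) (Q : pred (seq (option B)))
    (P : pred (seq B)) (Q1 : pred (seq (option B))) n :
  (forall u v, Q (map Some u ++ None :: v) = P u && Q1 v) ->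
  count_words Q n = count_words (fun u => Q (map Some u)) n +
    \sum_(i < n) count_words P i * count_words Q1 (n.-1 - i).
Proof.
elim: n Q P => [|n IH] Q P QP /=; first by rewrite big_ord0 addn0.
rewrite (bigD1 None) //= [X in X + _](_ : _ = P [::] * count_words Q1 n); last first.
  by rewrite -count_words_andb; apply: eq_count_words => v; apply: (QP [::]).
have -> : \sum_(b | b != None) count_words (fun w => Q (b :: w)) n =
    \sum_b count_words (fun w => Q (Some b :: w)) n.
  rewrite (reindex_omap Some id) /=; last by case.
  by apply: eq_bigl => b; rewrite eqxx.
under eq_bigr => b _.
  rewrite (IH _ (fun u => P (b :: u))); last by move=> u v; apply: (QP (b :: u)).
  over.
rewrite big_split /= addnCA; congr (_ + _).
rewrite big_ord_recl /= subn0; congr (_ + _).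
rewrite exchange_big /=; apply: eq_bigr => i _.
rewrite -big_distrl /=; congr (_ * count_words _ _).
by rewrite /bump /=; lia.
Qed.

(** * Words without factors in a given set *)

Section Avoidance.
Variable B : eqType.
Implicit Types (T : pred (seq B)) (w u v r : seq B).

(** The shape of [avoids] is that of [uniq] on the list of vertices visited by
    a walk: the first vertex does not come back, and so on recursively. *)
Definition no_prefix T w : bool :=
  ~~ has (fun i => T (take i.+1 w)) (iota 0 (size w)).

Fixpoint avoids T w : bool :=
  if w is _ :: w' then no_prefix T w && avoids T w' else true.

Lemma no_prefixP T w :
  reflect (forall v r, w = v ++ r -> v != [::] -> ~~ T v) (no_prefix T w).
Proof.
apply: (iffP hasPn) => [np v r wE v0|np i].
  have := np (size v).-1; rewrite mem_iota prednK ?lt0n ?size_eq0 // wE.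
  by rewrite take_size_cat //; apply; rewrite size_cat; case: v v0 {wE} => //=; lia.
rewrite mem_iota /= add0n => iw; apply: np (esym (cat_take_drop i.+1 w)) _.
by rewrite -size_eq0 size_take_min; lia.
Qed.

Lemma avoidsP T w :
  reflect (forall u v r, w = u ++ v ++ r -> v != [::] -> ~~ T v) (avoids T w).
Proof.
elim: w => [|b w IH] /=.
  by constructor=> -[|//] [|//].
apply: (iffP andP) => [[/no_prefixP np /IH av] [|c u] v r|av].
- exact: (np v r).
- by case=> _; apply: (av u v r).
split; first by apply/no_prefixP => v r; apply: (av [::]).
by apply/IH => u v r wE; apply: (av (b :: u) v r); rewrite wE.
Qed.

Lemma avoids_cat T u v : avoids T (u ++ v) -> avoids T u && avoids T v.
Proof.
move=> /avoidsP av; apply/andP; split; apply/avoidsP => a b c E.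
  by apply: (av a b (c ++ v)); rewrite E !catA.
by apply: (av (u ++ a) b c); rewrite E !catA.
Qed.

Lemma sub_avoids T T' w :
  (forall v, size v <= size w -> T' v -> T v) -> avoids T w -> avoids T' w.
Proof.
move=> sub /avoidsP av; apply/avoidsP => u v r wE v0.
have := av _ _ _ wE v0; apply: contra; apply: sub.
by rewrite wE !size_cat; lia.
Qed.

(** A shortest word in [T] but not in [T'] has no non-empty factor in [T'],
    since deleting that factor would give a shorter one. *)
Lemma avoids_witness T T' w :
  (forall u v r, T' v -> T (u ++ v ++ r) = T (u ++ r)) ->
  (forall u v r, T' v -> T' (u ++ v ++ r) = T' (u ++ r)) ->
  T' [::] ->
  T w -> ~~ T' w -> exists v, [/\ avoids T' v, ~~ avoids T v & v != [::]].
Proof.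
move=> TT' T'T' T'0; have [n] := ubnP (size w); elim: n w => // n IH w szw Tw nT'w.
have w0 : w != [::] by apply: contraNneq nT'w => ->.
have [[u [v [r [wE v0 T'v]]]]|nex] :=
  pselect (exists u v r, [/\ w = u ++ v ++ r, v != [::] & T' v]); last first.
  exists w; split=> //.
    apply/avoidsP => u v r wE v0; apply/negP => T'v.
    by apply: nex; exists u, v, r.
  apply/negP => /avoidsP /(_ [::] w [::]).
  by rewrite cats0 => /(_ erefl w0); rewrite Tw.
apply: (IH (u ++ r)); rewrite ?wE in szw Tw nT'w *.
- rewrite !size_cat in szw *; have: 0 < size v by rewrite lt0n size_eq0.
  by lia.
- by rewrite -(TT' u v).
- by rewrite -(T'T' u v).
Qed.
End Avoidance.

(** The words that the free product with Z/2 adds: [None] is the new involution,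
    and a word is forced to return if it contains [None] twice in a row or a
    word of [E] in the old letters.  The lemmas below say that a word avoids
    these patterns exactly when its maximal blocks of old letters avoid [E] and
    the inner blocks are not empty. *)
Section FreeAvoidance.
Variables (B : eqType) (E : pred (seq B)).
Implicit Types (u v : seq B) (w : seq (option B)).

Definition free_relator w : bool :=
  (w == [:: None; None]) || (all isSome w && E (pmap id w)).

Let F := free_relator.

Lemma free_relator_map u : F (map Some u) = E u.
Proof.
rewrite /F /free_relator.
have -> : (map Some u == [:: None; None]) = false by case: u.
have -> : all isSome (map Some u) by elim: u.
by have -> : pmap id (map Some u) = u by elim: u => //= b u ->.
Qed.

Lemma no_prefix_map u : no_prefix F (map Some u) = no_prefix E u.
Proof.
congr (~~ _); rewrite size_map; apply: eq_has => i.
by rewrite -map_take free_relator_map.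
Qed.

Lemma no_prefix_map_cat b u w :
  no_prefix F (map Some (b :: u) ++ None :: w) = no_prefix E (b :: u).
Proof.
rewrite -no_prefix_map; apply/no_prefixP/no_prefixP => np v r E1 v0.
  by apply: (np v (r ++ None :: w)); rewrite // E1 catA.
have [sv|sv] := leqP (size v) (size (b :: u)).
  apply: (np v (drop (size v) (map Some (b :: u)))) => //.
  rewrite -[LHS](cat_take_drop (size v)); congr (_ ++ _).
  have := congr1 (take (size v)) E1.
  by rewrite take_size_cat // takel_cat ?size_map.
have [w' ->] : exists w', v = map Some (b :: u) ++ None :: w'.
  exists (take (size v - size (b :: u)).-1 w).
  have := congr1 (take (size v)) E1; rewrite take_size_cat // => {1}<-.
  rewrite take_cat size_map ltnNge (ltnW sv).
  by case: (size v - _) (esym (subn_gt0 (size (b :: u)) (size v))); rewrite ?sv.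
rewrite /F /free_relator negb_or; apply/andP; split; last first.
  by rewrite negb_and all_cat /= andbF.
by case: (u).
Qed.

Lemma avoids_map u : avoids F (map Some u) = avoids E u.
Proof. by elim: u => //= b u ->; rewrite -no_prefix_map. Qed.

Lemma avoids_map_cat u w :
  avoids F (map Some u ++ None :: w) = avoids E u && avoids F (None :: w).
Proof.
elim: u => // b u IH.
rewrite [LHS]/= -cat_cons -/(map Some (b :: u)).
by rewrite no_prefix_map_cat IH andbA.
Qed.

Lemma no_prefix_None w : no_prefix F (None :: w) = (ohead w != Some None).
Proof.
apply/no_prefixP/idP => [np|w0 [|a v] r //= [<-] wE _].
  case: w np => // -[b|] w //= /(_ [:: None; None] w erefl isT).
  by rewrite /F /free_relator.
rewrite /F /free_relator /= orbF; apply: contraNneq w0 => -[vE].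
by rewrite wE vE.
Qed.

Lemma avoids_None_map u : avoids F (None :: map Some u) = avoids E u.
Proof. by rewrite -avoids_map /= no_prefix_None; case: u. Qed.

Lemma avoids_None_map_cat u w :
  avoids F (None :: map Some u ++ None :: w) =
  (u != [::]) && avoids E u && avoids F (None :: w).
Proof.
rewrite -andbA -avoids_map_cat [LHS]/= no_prefix_None.
by case: u.
Qed.

End FreeAvoidance.

(** * Actions and the free product with Z/2 *)

Section Action.
Variables (B : finType) (X : Type) (act : B -> X -> X).
Implicit Types (w u v r : seq B).

Definition act_word w x := foldl (fun x b => act b x) x w.

Definition trivial_word w : bool := `[< forall x, act_word w x = x >].

Lemma act_word_cat u v x : act_word (u ++ v) x = act_word v (act_word u x).
Proof. exact: foldl_cat. Qed.

Lemma trivial_word_nil : trivial_word [::].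
Proof. exact/asboolP. Qed.

Lemma trivial_word_infix u v r :
  trivial_word v -> trivial_word (u ++ v ++ r) = trivial_word (u ++ r).
Proof.
move=> /asboolP v1; apply: asbool_equiv_eq.
by split=> h x; have := h x; rewrite !act_word_cat v1.
Qed.

Lemma nontrivial_word w : ~~ trivial_word w -> exists x, act_word w x <> x.
Proof. by move=> /asboolPn /existsNP. Qed.
End Action.

(** An explicit faithful action of the free product with Z/2, for a faithful
    action on a set with at least two points.  A state is a current point [y]
    with a stack [l] of points; the sequence [beta] assigns a base point to every
    height of the stack.  The extra generator pushes the current point and restarts from the
    base point of the next level, unless the current point is the base point of
    its level, in which case it pops.  The tests on the popped point make this
    an involution on all states, whatever the points in the stack. *)
Section FreeExtension.
Variables (B : finType) (Y : eqType) (act : B -> Y -> Y).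

Definition free_state : Type := (nat -> Y) * (Y * seq Y).

Definition free_act (b : option B) (p : free_state) : free_state :=
  let: (beta, (y, l)) := p in
  if b is Some s then (beta, (act s y, l))
  else if y != beta (size l) then (beta, (beta (size l).+1, y :: l))
  else if l is y' :: l' then
    if y' != beta (size l') then (beta, (y', l')) else p
  else p.

Lemma free_act_NoneK : involutive (free_act None).
Proof.
case=> beta [y l] /=; have [yb|yb] /= := eqVneq y (beta (size l)).
  case: l yb => [|y' l] /= yb; first by rewrite yb eqxx.
  have [y'b|y'b] /= := eqVneq y' (beta (size l)); rewrite ?yb ?eqxx /=.
    by rewrite y'b eqxx.
  by rewrite y'b.
by rewrite eqxx /= yb.
Qed.

Lemma free_act_SomeK s s' : cancel (act s) (act s') ->
  cancel (free_act (Some s)) (free_act (Some s')).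
Proof. by move=> sK [beta [y l]] /=; rewrite sK. Qed.

Lemma free_act_map u beta y l :
  act_word free_act (map Some u) (beta, (y, l)) = (beta, (act_word act u y, l)).
Proof. by elim: u y => //= b u IH y; rewrite -IH. Qed.

Lemma split_at_None (w : seq (option B)) :
  (exists u, w = map Some u) \/ (exists u v, w = map Some u ++ None :: v).
Proof.
elim: w => [|[b|] w IH]; first by left; exists [::].
  case: IH => [[u ->]|[u [v ->]]]; [left; exists (b :: u)|right] => //.
  by exists (b :: u), v.
by right; exists [::], w.
Qed.

Local Notation E := (trivial_word act).
Local Notation F := (free_relator E).

Lemma avoids_moves u : avoids E u -> u != [::] -> exists y, act_word act u y <> y.
Proof.
move=> /avoidsP /(_ [::] u [::]); rewrite cats0 => /(_ erefl) h u0.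
exact/nontrivial_word/h.
Qed.

(** Ping-pong: if the base point of each level is chosen to be moved by the
    block read at that level, then every occurrence of [None] pushes, and the
    stack never goes back to its initial height. *)
Lemma free_act_pushes (y0 : Y) w k : avoids F (None :: w) ->
  exists gamma : nat -> Y,
  forall beta, (forall i, k < i -> beta i = gamma i) ->
  forall y l, size l = k -> y != beta k ->
  k < size (act_word free_act (None :: w) (beta, (y, l))).2.2.
Proof.
have [n] := ubnP (size w); elim: n w k => // n IH w k.
have [[u ->] _ _|[u [v ->]] szw] := split_at_None w.
  exists (fun=> y0) => beta _ y l <- yb.
  by rewrite /= yb -/(act_word _ _ _) free_act_map.
rewrite avoids_None_map_cat => /andP[/andP[u0 avu] avv].
have [y1 uy1] := avoids_moves avu u0.
have szv : size v < n by move: szw; rewrite size_cat /=; lia.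
have [gamma gammaP] := IH v k.+1 szv avv.
exists (fun i => if i == k.+1 then y1 else gamma i) => beta betaE y l lk yb.
have sl : size (y :: l) = k.+1 by rewrite /= lk.
have bk1 : beta k.+1 = y1 by rewrite betaE // eqxx.
rewrite -cat_cons act_word_cat /= lk yb -/(act_word _ _ _) free_act_map bk1.
apply: ltnW; apply: gammaP => //.
  by move=> i ki; rewrite betaE ?gtn_eqF // ltnW.
by rewrite bk1; apply/eqP.
Qed.

Lemma avoids_free_nontrivial (y0 : Y) (w : seq (option B)) :
  (forall y : Y, exists y', y != y') ->
  avoids F w -> w != [::] -> ~~ trivial_word free_act w.
Proof.
move=> neY; have [[u ->]|[u [v ->]]] := split_at_None w.
  rewrite avoids_map => avu u0.
  have [|y uy] := avoids_moves avu; first by case: (u) u0.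
  apply/negP => /asboolP /(_ ((fun=> y), (y, [::]))).
  by rewrite free_act_map => -[].
rewrite avoids_map_cat => /andP[_ avv] _.
have [gamma gammaP] := free_act_pushes y0 0 avv.
have [a ua] := neY (act_word act u y0).
pose beta i := if i == 0 then a else gamma i.
apply/negP => /asboolP /(_ (beta, (y0, [::]))) /(congr1 (fun p => size p.2.2)).
rewrite act_word_cat free_act_map => uv.
have betaE i : 0 < i -> beta i = gamma i by case: i.
by have := gammaP beta betaE (act_word act u y0) [::] erefl ua; rewrite uv.
Qed.

Lemma free_relator_trivial (w : seq (option B)) : F w -> trivial_word free_act w.
Proof.
case/orP => [/eqP ->|/andP[sw Ew]]; apply/asboolP.
  exact: free_act_NoneK.
have -> : w = map Some (pmap id w) by elim: w sw {Ew} => //= -[b|] w //= IH /IH <-.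
by move/asboolP: Ew => Ew [beta [y l]]; rewrite free_act_map Ew.
Qed.

Lemma avoids_free (y0 : Y) (w : seq (option B)) :
  (forall y : Y, exists y', y != y') ->
  avoids (trivial_word free_act) w = avoids F w.
Proof.
move=> neY; apply/idP/idP.
  by apply: sub_avoids => v _; apply: free_relator_trivial.
move=> avw; apply/avoidsP => u v r wE; apply: (avoids_free_nontrivial y0) => //.
by move: avw; rewrite wE => /avoids_cat/andP[_ /avoids_cat/andP[]].
Qed.
End FreeExtension.

(** * The group generated by an action and its Cayley graph *)

Record inv_action (B : finType) (X : Type) := InvAction {
  letter_act :> B -> X -> X;
  letter_inv : B -> B;
  letter_invK : involutive letter_inv;
  letter_actK : forall b, cancel (letter_act b) (letter_act (letter_inv b)) }.

Section WordGroup.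
Variables (B : finType) (X : Type) (act : inv_action B X).

(** Elements are functions, so that two words define the same element if and
    only if they act in the same way. *)
Definition word_group : Type := {f : X -> X | exists w, f = act_word act w}.

Definition word_elt w : word_group := exist _ (act_word act w) (ex_intro _ w erefl).

Lemma word_group_inj (g h : word_group) : sval g =1 sval h -> g = h.
Proof.
case: g h => [g gP] [h hP] /= gh; apply: eq_exist => /=.
exact/funext.
Qed.

Lemma word_eltP (g : word_group) : {w | g = word_elt w}.
Proof.
have [w gw] := cid (svalP g).
by exists w; apply: word_group_inj => x; rewrite gw.
Qed.

Lemma word_elt_eq u v : word_elt u = word_elt v <->
  (forall x, act_word act u x = act_word act v x).
Proof.
split=> [|uv]; last exact: word_group_inj.
by move=> /(congr1 sval) /= uv x; rewrite uv.
Qed.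

Definition inv_word (w : seq B) := rev (map (letter_inv act) w).

Lemma inv_wordK w : cancel (act_word act w) (act_word act (inv_word w)).
Proof.
elim: w => // b w IH x.
by rewrite /inv_word map_cons rev_cons -cats1 act_word_cat IH /= letter_actK.
Qed.

Lemma inv_word_inv w : inv_word (inv_word w) = w.
Proof.
rewrite /inv_word map_rev revK -map_comp -[RHS]map_id; apply: eq_map => b /=.
exact: letter_invK.
Qed.

HB.instance Definition _ := gen_eqMixin word_group.
HB.instance Definition _ := gen_choiceMixin word_group.

Definition word_mul (g h : word_group) : word_group :=
  word_elt (sval (word_eltP g) ++ sval (word_eltP h)).
Definition word_inverse (g : word_group) : word_group :=
  word_elt (inv_word (sval (word_eltP g))).

Lemma word_mulE u v : word_mul (word_elt u) (word_elt v) = word_elt (u ++ v).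
Proof.
rewrite /word_mul; case: word_eltP => u' /= /word_elt_eq uE.
case: word_eltP => v' /= /word_elt_eq vE; apply/word_elt_eq => x.
by rewrite !act_word_cat uE vE.
Qed.

Lemma word_inverseE u : word_inverse (word_elt u) = word_elt (inv_word u).
Proof.
rewrite /word_inverse; case: word_eltP => v /= /word_elt_eq uE.
apply/word_elt_eq => x; rewrite -[in LHS](inv_wordK (inv_word u) x) inv_word_inv.
by rewrite uE inv_wordK.
Qed.

Fact word_mulA : associative word_mul.
Proof.
move=> g h k; have [u ->] := word_eltP g; have [v ->] := word_eltP h.
by have [w ->] := word_eltP k; rewrite !word_mulE catA.
Qed.

Fact word_mul1g : left_id (word_elt [::]) word_mul.
Proof. by move=> g; have [u ->] := word_eltP g; rewrite word_mulE. Qed.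

Fact word_mulg1 : right_id (word_elt [::]) word_mul.
Proof. by move=> g; have [u ->] := word_eltP g; rewrite word_mulE cats0. Qed.

Fact word_mulgV : right_inverse (word_elt [::]) word_inverse word_mul.
Proof.
move=> g; have [u ->] := word_eltP g; rewrite word_inverseE word_mulE.
by apply/word_elt_eq => x; rewrite act_word_cat inv_wordK.
Qed.

Fact word_mulVg : left_inverse (word_elt [::]) word_inverse word_mul.
Proof.
move=> g; have [u ->] := word_eltP g; rewrite word_inverseE word_mulE.
by apply/word_elt_eq => x; rewrite act_word_cat -{1}[u]inv_word_inv inv_wordK.
Qed.

HB.instance Definition _ := isGroup.Build word_group
  word_mulA word_mul1g word_mulg1 word_mulVg word_mulgV.

Local Open Scope group_scope.

Lemma word_eltM u v : word_elt (u ++ v) = word_elt u * word_elt v.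
Proof. by rewrite -word_mulE. Qed.

Lemma word_eltV u : (word_elt u)^-1 = word_elt (inv_word u).
Proof. by rewrite -word_inverseE. Qed.

Lemma word_elt_eq1 u : (word_elt u == 1) = trivial_word act u.
Proof. 
apply/eqP/asboolP => [ue|u1]; first exact/(word_elt_eq u [::]).
exact/(word_elt_eq u [::]).
Qed.

Definition letter b : word_group := word_elt [:: b].
Definition letters : {fset word_group} := [fset letter b | b in B]%fset.

Lemma mem_letters b : letter b \in letters.
Proof. exact: in_imfset. Qed.

Lemma generating_letters : generating letters.
Proof.
move=> H Hgrp lH g; have [w ->] := word_eltP g.
elim: w => [|b w IH]; first by case: Hgrp.
rewrite -cat1s word_eltM; apply: group_closedM => //.
exact/lH/mem_letters.
Qed.

Local Notation e := (cayley_graph letters).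
Local Notation T := (trivial_word act).

Lemma cayley_edgeP g h : g != h -> reflect (exists b, h = g * letter b) (e g h).
Proof.
move=> gh; rewrite /cayley_graph gh /= inE; apply: (iffP orP) => [|[b ->]].
  have hE : h = g * (g^-1 * h) by rewrite mulgA mulgV mul1g.
  case=> [/imfsetP[b _ bE]|/imfsetP[x /imfsetP[b _ ->] bE]].
    by exists b; rewrite hE bE.
  by exists (letter_inv act b); rewrite hE bE word_eltV.
by left; rewrite mulgA mulVg mul1g mem_letters.
Qed.

Definition walk (o : word_group) (w : seq B) := scanl (fun g b => g * letter b) o w.

(** The walk returns to its origin exactly at the prefixes of the word that
    represent the identity. *)
Lemma walkE o w :
  walk o w = [seq o * word_elt (take i.+1 w) | i <- iota 0 (size w)].
Proof.
elim: w o => // b w IH o; rewrite /= take0; congr (_ :: _).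
rewrite -/(walk _ _) IH -[1%N]addn0 iotaDl -map_comp; apply: eq_map => i /=.
by rewrite -[b :: _]cat1s word_eltM mulgA.
Qed.

Lemma uniq_walk o w : uniq (o :: walk o w) = avoids T w.
Proof.
elim: w o => // b w IH o.
rewrite [RHS]/= -(IH (o * letter b)) [walk _ _]/= -/(walk _ _) cons_uniq.
congr (~~ _ && _).
rewrite -[_ :: walk _ _]/(walk o (b :: w)) walkE -has_pred1 has_map.
apply: eq_has => i /=.
by rewrite -word_elt_eq1 -{2}(mulg1 o) (can_eq (mulKg o)).
Qed.

Lemma path_walk o w : uniq (o :: walk o w) -> path e o (walk o w).
Proof.
elim: w o => // b w IH o.
have -> : walk o (b :: w) = o * letter b :: walk (o * letter b) w by [].
rewrite cons_uniq => /andP[out /IH pw].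
rewrite /= pw andbT; apply/cayley_edgeP; last by exists b.
by apply: contraNneq out => <-; rewrite mem_head.
Qed.

Lemma path_is_walk o p : path e o p -> exists2 w, size w = size p & p = walk o w.
Proof.
elim: p o => [|g p IH] o /=; first by exists [::].
move=> /andP[eog /IH [w _ ->]]; have og : o != g by case/andP: eog.
move/(cayley_edgeP og): eog => [b gE]; exists (b :: w); last by rewrite gE.
by rewrite /= size_scanl.
Qed.

Lemma walk_inj o : injective letter -> injective (walk o).
Proof.
move=> inj u; elim: u o => [|b u IH] o [|c v] // uv.
have /mulgI/inj bc := congr1 (head 1) uv.
by have /= := congr1 behead uv; rewrite bc => /IH ->.
Qed.

(** When distinct letters are distinct group elements, distinct words trace
    distinct walks, and every walk in the Cayley graph is traced by a word. *)
Lemma saw_count_letters o n : injective letter ->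
  saw_count e o n = count_words (avoids T) n.
Proof.
move=> inj; rewrite /saw_count -card_count_words.
pose f (w : n.-tuple B) := walk o w.
have finj : injective f by move=> u v /(walk_inj inj)/val_inj.
pose W := [set w : n.-tuple B | avoids T w]%SET.
have -> : fset_set (self_avoiding_paths e o n) = [fset f w | w in W]%fset.
  apply/fsetP => p; rewrite in_fset_set; last exact: finite_self_avoiding_paths.
  apply/idP/imfsetP => [|[w /= wW ->]].
    rewrite inE /= => -[sp /path_is_walk[w sw pE] up].
    have swn : size w == n by rewrite sw sp.
    by exists (Tuple swn) => //=; rewrite inE /= -(uniq_walk o) -pE.
  rewrite inE; rewrite inE -(uniq_walk o) in wW; split=> //.
    by rewrite /f size_scanl size_tuple.
  exact: path_walk.
by rewrite card_imfset //= -cardE.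
Qed.

End WordGroup.

(** * Growth rates of submultiplicative sequences *)

Section Growth.
Local Open Scope ring_scope.
Variable R : realType.
Implicit Types (h : nat -> nat) (y : R).

(** The infimum of the n-th roots of [h n], phrased without roots so as to be
    compared with integer powers. *)
Definition growth h : R :=
  inf [set y : R | 0 <= y /\ exists2 n, (0 < n)%N & (h n)%:R <= y ^+ n].

Lemma root_powR (a : R) n : 0 <= a -> (0 < n)%N -> (a `^ n%:R^-1) ^+ n = a.
Proof.
move=> a0 n0; rewrite -powR_mulrn ?powR_ge0 // -powRrM mulVf ?powRr1 //.
by rewrite pnatr_eq0 -lt0n.
Qed.

Section Positive.
Variable h : nat -> nat.
Hypothesis h_gt0 : forall n, (0 < h n)%N.

Let growth_lbound : lbound [set y : R | 0 <= y /\
  exists2 n, (0 < n)%N & (h n)%:R <= y ^+ n] 1.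
Proof.
move=> y [y0 [n n0 hy]]; rewrite leNgt; apply/negP => y1.
have : y ^+ n < 1 by rewrite exprn_ilt1 -?lt0n.
by rewrite ltNge (le_trans _ hy) // ler1n.
Qed.

Let growth_nonempty : [set y : R | 0 <= y /\
  exists2 n, (0 < n)%N & (h n)%:R <= y ^+ n] !=set0.
Proof. by exists (h 1)%:R; split=> //; exists 1. Qed.

Lemma growth_ge1 : 1 <= growth h.
Proof. exact: lb_le_inf. Qed.

Lemma growth_gt0 : 0 < growth h.
Proof. exact: lt_le_trans growth_ge1. Qed.

Lemma growth_le_root n y : 0 <= y -> (0 < n)%N -> (h n)%:R <= y ^+ n ->
  growth h <= y.
Proof.
move=> y0 n0 hy; apply: ge_inf; first by exists 1.
by split=> //; exists n.
Qed.

Lemma growth_exp_le n : growth h ^+ n <= (h n)%:R.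
Proof.
case: n => [|n]; first by rewrite expr0 ler1n.
rewrite -[leRHS](@root_powR _ n.+1) // ler_pXn2r ?nnegrE ?powR_ge0 ?(ltW growth_gt0) //.
by apply: (@growth_le_root n.+1); rewrite ?powR_ge0 // root_powR.
Qed.

Lemma growth_lt_exp y : growth h < y -> exists2 n, (0 < n)%N & (h n)%:R < y ^+ n.
Proof.
move=> /(inf_lt growth_nonempty) [x [x0 [n n0 hx]] xy].
exists n => //; apply: le_lt_trans hx _.
by rewrite ltr_pXn2r ?nnegrE // ltW // (le_lt_trans x0).
Qed.
End Positive.

Lemma growth_le h h' : (forall n, (0 < h n)%N) -> (forall n, (0 < h' n)%N) ->
  (forall n, (h n <= h' n)%N) -> growth h <= growth h'.
Proof.
move=> hp hp' hh'; rewrite leNgt; apply/negP => /growth_lt_exp [n n0].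
by rewrite ltNge (le_trans (growth_exp_le hp n)) // ler_nat.
Qed.

Lemma submult_exp h m q r : (forall m n, (h (m + n) <= h m * h n)%N) ->
  (h (m * q + r) <= h m ^ q * h r)%N.
Proof.
move=> hsub; elim: q => [|q IH]; first by rewrite muln0 add0n expn0 mul1n.
rewrite mulnS -addnA (leq_trans (hsub _ _)) // expnS -mulnA.
by rewrite leq_mul2l IH orbT.
Qed.

(** Fekete: if h m <= y ^ m for one m > 0, then dividing n by m with remainder
    gives h n <= M * y ^ n, where the constant M accounts for the remainder and
    has n-th root tending to 1. *)
Lemma growth_cvg h : (forall n, (0 < h n)%N) ->
  (forall m n, (h (m + n) <= h m * h n)%N) ->
  (h n)%:R `^ n%:R^-1 @[n --> \oo] --> growth h.
Proof.
move=> hp hsub; apply/cvgrPdist_lt => eps eps0.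
have gy : growth h < growth h + eps / 2 by rewrite ltrDl divr_gt0.
set y := growth h + eps / 2 in gy.
have [m m0 hm] := growth_lt_exp gy.
have y1 : 1 <= y by rewrite ltW // (le_lt_trans (growth_ge1 hp)).
have y0 : 0 < y by apply: lt_le_trans y1.
pose M : R := (\max_(r < m) h r)%:R + 1.
have M0 : 0 < M by rewrite ltr_wpDl.
have hM n : (h n)%:R <= y ^+ n * M.
  rewrite {1}(divn_eq n m) mulnC.
  apply: (@le_trans _ _ ((h m ^ (n %/ m) * h (n %% m))%N%:R)).
    by rewrite ler_nat submult_exp.
  rewrite natrM natrX; apply: ler_pM; rewrite ?exprn_ge0 //.
    apply: (@le_trans _ _ ((y ^+ m) ^+ (n %/ m))).
      by rewrite lerXn2r ?nnegrE ?exprn_ge0 ?ler0n ?(ltW y0) ?(ltW hm).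
    by rewrite -exprM ler_weXn2l // mulnC leq_divM.
  rewrite /M ler_wpDr // ler_nat.
  by rewrite (leq_bigmax (Ordinal (ltn_pmod n m0))).
have cvgM : y * M `^ n%:R^-1 @[n --> \oo] --> y.
  have cvgV : (n%:R : R)^-1 @[n --> \oo] --> (0 : R).
    apply/gtr0_cvgV0; last exact: cvgr_idn.
    by apply: filterS (nbhs_infty_gt 0) => n; rewrite ltr0n.
  have -> : (fun n : nat => y * M `^ n%:R^-1) =
      (fun n : nat => y * expR (n%:R^-1 * ln M)).
    by apply/funext => n; rewrite /powR gt_eqF.
  rewrite (_ : nbhs y = nbhs (y * expR (0 * ln M))); last by rewrite mul0r expR0 mulr1.
  apply: cvgMl_tmp.
  apply: continuous_cvg; first exact: continuous_expR.
  exact: (cvgMr_tmp cvgV).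
have gye : y < growth h + eps by rewrite ltrD2l ltr_pdivrMr // ltr_pMr // ltr1n.
move/cvgrPdist_lt: (cvgM) => /(_ (growth h + eps - y)).
rewrite subr_gt0 => /(_ gye); apply: filterS2 (nbhs_infty_gt 0) => n n0 yM.
have lo : growth h <= (h n)%:R `^ n%:R^-1.
  by apply: (@growth_le_root h hp n); rewrite ?powR_ge0 ?root_powR.
rewrite distrC ger0_norm ?subr_ge0 // ltrBlDr addrC.
have up : (h n)%:R `^ n%:R^-1 <= y * M `^ n%:R^-1.
  rewrite -(@ler_pXn2r _ n) ?nnegrE ?mulr_ge0 ?powR_ge0 ?(ltW y0) //.
  by rewrite exprMn !root_powR // ltW.
apply: le_lt_trans up _.
by move: yM; rewrite distrC => /(le_lt_trans (ler_norm _)); rewrite ltrD2r.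
Qed.

End Growth.

(** * Strict monotonicity of the growth rate in a renewal structure *)

Section Convolution.
Local Open Scope ring_scope.
Variable R : realType.

(** Every pair of indices occurs at most once on the left. *)
Lemma sum_convolution (a b : nat -> R) N :
  (forall i, 0 <= a i) -> (forall i, 0 <= b i) ->
  \sum_(n < N) \sum_(i < n) a i * b (n.-1 - i)%N <=
  (\sum_(i < N) a i) * (\sum_(j < N) b j).
Proof.
move=> + b0; elim: N a => [|N IH] a a0; first by rewrite !big_ord0 mul0r.
rewrite big_ord_recl big_ord0 add0r.
have step n : \sum_(i < n.+1) a i * b (n - i)%N =
    a 0 * b n + \sum_(i < n) a i.+1 * b (n.-1 - i)%N.
  rewrite big_ord_recl subn0; congr (_ + _); apply: eq_bigr => i _.
  by rewrite lift0; congr (_ * b _); lia.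
rewrite (eq_bigr (fun n : 'I_N => a 0 * b n + \sum_(i < n) a i.+1 * b (n.-1 - i)%N));
  last by move=> n _; apply: step.
rewrite big_split /= -big_distrr /=.
have bN : \sum_(j < N) b j <= \sum_(j < N.+1) b j by rewrite big_ord_recr /= lerDl.
rewrite [X in _ <= X * _]big_ord_recl mulrDl lerD ?ler_wpM2l //.
apply: le_trans (IH (fun i => a i.+1) _) _ => //.
by rewrite ler_wpM2l // sumr_ge0.
Qed.
End Convolution.

(** Inner blocks are not empty, hence the term of index 0 is dropped. *)
Definition inner_blocks (c : nat -> nat) (i : nat) : nat :=
  if i == 0%N then 0%N else c i.

(** Here c counts the words allowed in a block, k counts the words that may
    follow the separating letter, and h counts all words.  In terms of
    generating series, K = C + z (C - c 0) K and H = C + z C K. *)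
Section Renewal.
Local Open Scope ring_scope.
Variable R : realType.
Variables (c k : nat -> nat).
Local Notation d := (inner_blocks c).
Hypothesis kE : forall n, k n = (c n + \sum_(i < n) d i * k (n.-1 - i))%N.

Let w (z : R) (u : nat -> nat) N := \sum_(i < N) (u i)%:R * z ^+ i.

Let wconv (z : R) (a b : nat -> nat) N : 0 <= z ->
  \sum_(n < N) (\sum_(i < n) a i * b (n.-1 - i))%N%:R * z ^+ n <=
  z * (w z a N * w z b N).
Proof.
move=> z0; have := @sum_convolution R (fun i => (a i)%:R * z ^+ i)
  (fun i => (b i)%:R * z ^+ i) N.
move=> /(_ (fun=> mulr_ge0 (ler0n _ _) (exprn_ge0 _ z0))).
move=> /(_ (fun=> mulr_ge0 (ler0n _ _) (exprn_ge0 _ z0))).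
move=> /(ler_wpM2l z0); apply: le_trans.
rewrite big_distrr /= le_eqVlt; apply/orP; left; apply/eqP.
apply: eq_bigr => n _; rewrite natr_sum big_distrl big_distrr /=.
apply: eq_bigr => i _; rewrite natrM.
have -> : z ^+ n = z * (z ^+ i * z ^+ (n.-1 - i)).
  by rewrite -exprD -exprS; congr (_ ^+ _); have := ltn_ord i; lia.
by ring.
Qed.

(** The partial sums of K satisfy K <= C + q K, so K is bounded if q < 1. *)
Lemma renewal_bounded (h : nat -> nat) (z q : R) :
  (forall n, h n = (c n + \sum_(i < n) c i * k (n.-1 - i))%N) ->
  0 < z -> q < 1 ->
  (forall N, \sum_(i < N) (d i)%:R * z ^+ i.+1 <= q) ->
  exists C, forall N, \sum_(n < N) (h n)%:R * z ^+ n <= C.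
Proof.
move=> hE z0 q1 dq.
have zd N : z * w z d N <= q.
  apply: le_trans (dq N); rewrite big_distrr /= le_eqVlt; apply/orP; left.
  by apply/eqP; apply: eq_bigr => i _; rewrite exprS; ring.
have w_ge0 u N : 0 <= w z u N.
  by apply: sumr_ge0 => i _; rewrite mulr_ge0 // exprn_ge0 // ltW.
pose C : R := (c 0)%:R + q / z.
have wc N : w z c N <= C.
  case: N => [|N]; first by rewrite /w big_ord0 addr_ge0 // divr_ge0 ?(ltW z0) //
    (le_trans _ (dq 0)) // big_ord0.
  rewrite /w big_ord_recl expr0 mulr1 lerD2l ler_pdivlMr // mulrC.
  apply: le_trans (zd N.+1); rewrite ler_pM2l // [leRHS]big_ord_recl.
  by rewrite /inner_blocks /= mul0r add0r.
have C0 : 0 <= C by apply: le_trans (w_ge0 c 0) (wc 0).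
have wk N : w z k N <= C / (1 - q).
  rewrite ler_pdivlMr ?subr_gt0 // mulrBr mulr1 lerBlDr.
  rewrite {1}/w; under eq_bigr => n _ do rewrite kE natrD mulrDl.
  rewrite big_split /=; apply: lerD; first exact: wc.
  apply: le_trans (wconv _ _ _ (ltW z0)) _.
  by rewrite mulrA mulrC ler_wpM2l.
exists (C + z * (C * (C / (1 - q)))) => N.
under eq_bigr => n _ do rewrite hE natrD mulrDl.
rewrite big_split /=; apply: lerD; first exact: wc.
apply: le_trans (wconv _ _ _ (ltW z0)) _.
by rewrite ler_pM2l // ler_pM.
Qed.

Hypotheses (c0 : (0 < c 0)%N) (c1 : (0 < c 1)%N).

Lemma renewal_gt0 n : (0 < k n)%N.
Proof.
have [m] := ubnP n; elim: m n => // m IH [|[|n]] nm; rewrite kE ?addn_gt0 ?c0 ?c1 //.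
rewrite (bigD1 (Ordinal (isT : 1 < n.+2)%N)) //= /inner_blocks /= addn_gt0 muln_gt0 c1 IH.
  by rewrite orbT.
by lia.
Qed.

(** If the weights of the first M blocks add up to at least 1, then every
    term k n * y ^ n with n > M is at least a combination of M earlier ones, with
    total weight at least 1. *)
Lemma renewal_lower (y : R) M : 0 < y -> y <= 1 ->
  1 <= \sum_(i < M) (d i)%:R * y ^+ i.+1 -> forall n, y ^+ M <= (k n)%:R * y ^+ n.
Proof.
move=> y0 y1 dy n; have [m] := ubnP n; elim: m n => // m IH n nm.
have [nM|Mn] := leqP n M.
  apply: (@le_trans _ _ (y ^+ n)); first by rewrite ler_wiXn2l // ltW.
  by rewrite ler_peMl ?exprn_ge0 ?(ltW y0) // ler1n renewal_gt0.
have -> : (k n)%:R * y ^+ n = (c n)%:R * y ^+ n +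
    \sum_(i < n) ((d i)%:R * y ^+ i.+1) * ((k (n.-1 - i))%:R * y ^+ (n.-1 - i)).
  rewrite kE natrD mulrDl natr_sum big_distrl /=; congr (_ + _).
  apply: eq_bigr => i _; rewrite natrM.
  have -> : y ^+ n = y ^+ i.+1 * y ^+ (n.-1 - i).
    by rewrite -exprD; congr (_ ^+ _); have := ltn_ord i; lia.
  by ring.
rewrite ler_wpDl ?mulr_ge0 ?exprn_ge0 ?(ltW y0) //.
have t0 i : 0 <= (d i)%:R * y ^+ i.+1 by rewrite mulr_ge0 ?exprn_ge0 ?(ltW y0).
have -> : y ^+ M = 1 * y ^+ M by rewrite mul1r.
apply: (@le_trans _ _ (\sum_(i < n) (d i)%:R * y ^+ i.+1 * y ^+ M)).
  rewrite -big_distrl /= ler_wpM2r ?exprn_ge0 ?(ltW y0) //.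
  apply: le_trans dy _.
  rewrite -!(big_mkord xpredT (fun i => (d i)%:R * y ^+ i.+1)).
  by rewrite [leRHS](big_cat_nat (leq0n M) (ltnW Mn)) //= lerDl sumr_ge0.
apply: ler_sum => i _; rewrite ler_wpM2l //; apply: IH.
by have := ltn_ord i; lia.
Qed.

End Renewal.

Section Strict.
Local Open Scope ring_scope.
Variable R : realType.
Variables (c k h c' k' h' : nat -> nat).
Hypothesis kE : forall n,
  k n = (c n + \sum_(i < n) inner_blocks c i * k (n.-1 - i))%N.
Hypothesis hE : forall n, h n = (c n + \sum_(i < n) c i * k (n.-1 - i))%N.
Hypothesis kE' : forall n,
  k' n = (c' n + \sum_(i < n) inner_blocks c' i * k' (n.-1 - i))%N.
Hypotheses (c0' : (0 < c' 0)%N) (c1' : (0 < c' 1)%N).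
Hypothesis h_gt0 : forall n, (0 < h n)%N.
Hypothesis submult_h' : forall m n, (h' (m + n) <= h' m * h' n)%N.
Hypothesis h'0 : h' 0 = 1%N.
Hypothesis kh' : forall n, (k' n <= h' n)%N.
Hypothesis cc' : forall n, (c n <= c' n)%N.

(** Let z be the inverse of the growth rate of h.  As h n * z ^ n >= 1, the
    series H diverges at z, so the total weight q of the blocks of c at z is at
    least 1 in the limit.  One more block makes it exceed 1 strictly, for c' and
    finitely many blocks; it is then still at least 1 at some y < z, which bounds
    h' n * y ^ n from below. *)
Lemma growth_lt m : (0 < m)%N -> (c m < c' m)%N -> growth R h < growth R h'.
Proof.
move=> m0 cm.
have [mu mu0 [mu1 mu_le ->]] : exists2 mu : R, 0 < mu &
    [/\ 1 <= mu, forall n, mu ^+ n <= (h n)%:R & growth R h = mu].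
  exists (growth R h); first exact: growth_gt0.
  by split=> [|n|]; [exact: growth_ge1|exact: growth_exp_le|].
have [z [z0 z1 zV]] : exists z : R, [/\ 0 < z, z <= 1 & z = mu^-1].
  by exists mu^-1; rewrite invr_gt0 invf_le1.
pose q (c : nat -> nat) (z : R) N := \sum_(i < N) (inner_blocks c i)%:R * z ^+ i.+1.
have q_mono a y M N : 0 <= y -> (M <= N)%N -> q a y M <= q a y N.
  move=> y0 MN; rewrite /q -!(big_mkord xpredT (fun i => (inner_blocks a i)%:R * y ^+ i.+1)).
  rewrite [leRHS](big_cat_nat (leq0n M) MN) //= lerDl sumr_ge0 // => i _.
  by rewrite mulr_ge0 // exprn_ge0.
have [N qN] : exists N, 1 - z ^+ m.+1 / 2 < q c z N.
  have [//|nex] := pselect (exists N, 1 - z ^+ m.+1 / 2 < q c z N).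
  have q1 : 1 - z ^+ m.+1 / 2 < 1 by rewrite gtrDl oppr_lt0 divr_gt0 ?exprn_gt0.
  have qle N : q c z N <= 1 - z ^+ m.+1 / 2.
    by rewrite leNgt; apply/negP => qN; apply: nex; exists N.
  have [C hC] := @renewal_bounded R c k kE h z (1 - z ^+ m.+1 / 2) hE z0 q1 qle.
  have := archi_boundP (le_trans _ (hC 0)).
  rewrite big_ord0 => /(_ (lexx _)); set N := Num.bound C.
  rewrite ltNge => /negP[]; apply: le_trans (hC N).
  rewrite -[leLHS](_ : \sum_(i < N) 1 = _); last by rewrite sumr_const card_ord.
  apply: ler_sum => i _; rewrite zV exprVn ler_pdivlMr ?exprn_gt0 // mul1r.
  exact: mu_le.
pose M := maxn N m.+1.
have q'M : 1 < q c' z M.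
  apply: (@lt_le_trans _ _ (q c z M + z ^+ m.+1)).
    have := q_mono c z N M (ltW z0) (leq_maxl _ _).
    have : 0 < z ^+ m.+1 by rewrite exprn_gt0.
    by lra.
  have mM : (m < M)%N by rewrite leq_max leqnn orbT.
  rewrite /q (bigD1 (Ordinal mM)) //= [leRHS](bigD1 (Ordinal mM)) //=.
  rewrite addrAC lerD //.
    rewrite /inner_blocks gtn_eqF // -[X in _ + X]mul1r -mulrDl ler_pM2r ?exprn_gt0 //.
    by rewrite natr1 ler_nat.
  apply: ler_sum => i _; rewrite ler_pM2r ?exprn_gt0 // ler_nat.
  by rewrite /inner_blocks; case: eqP.
have M0 : (0 < M)%N by rewrite leq_max orbT.
(* la is the factor for which la ^ M compensates exactly the excess over 1. *)
pose la := (q c' z M)^-1 `^ M%:R^-1.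
have q'0 : 0 < q c' z M by apply: lt_trans q'M.
have laM : la ^+ M = (q c' z M)^-1 by rewrite root_powR // invr_ge0 ltW.
have la0 : 0 < la by rewrite powR_gt0 // invr_gt0.
have la1 : la < 1.
  rewrite ltNge; apply/negP => /(exprn_ege1 M).
  by rewrite laM leNgt invf_lt1 // q'M.
pose y := la * z.
have y0 : 0 < y by rewrite mulr_gt0.
have yz : y < z by rewrite gtr_pMl.
have qy : 1 <= q c' y M.
  apply: (@le_trans _ _ (la ^+ M * q c' z M)); first by rewrite laM mulVf ?gt_eqF.
  rewrite /q big_distrr /=; apply: ler_sum => i _.
  rewrite mulrCA ler_wpM2l // exprMn ler_pM2r ?exprn_gt0 //.
  by rewrite ler_wiXn2l ?ltW.
have y1 : y <= 1 by rewrite (le_trans (ltW yz)).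
have ky n : y ^+ M <= (h' n)%:R * y ^+ n.
  apply: le_trans (renewal_lower kE' c0' c1' y0 y1 qy n) _.
  by rewrite ler_pM2r ?exprn_gt0 // ler_nat.
rewrite ltNge; apply/negP => h'mu.
have : growth R h' < y^-1.
  by apply: le_lt_trans h'mu _; rewrite -[mu]invrK -zV ltf_pV2 ?posrE.
move=> /growth_lt_exp [n n0]; rewrite exprVn => h'n.
(* Along multiples of n, h' decays with respect to y geometrically. *)
pose rho := (h' n)%:R * y ^+ n.
have rho1 : rho < 1 by rewrite /rho -ltr_pdivlMr ?exprn_gt0 // mul1r.
have rho0 : 0 <= rho by rewrite mulr_ge0 // exprn_ge0 // ltW.
have /cvgrPdist_lt /(_ (y ^+ M)) : (fun j => rho ^+ j) @ \oo --> 0.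
  by apply: cvg_expr; rewrite ger0_norm.
rewrite exprn_gt0 // => /(_ isT) [j _ /(_ j (leqnn j))] /=.
rewrite sub0r normrN ger0_norm ?exprn_ge0 // ltNge => /negP[].
apply: le_trans (ky (n * j)%N) _.
rewrite /rho [leRHS]exprMn -exprM ler_pM2r ?exprn_gt0 // -natrX ler_nat.
by have := submult_exp n j 0 submult_h'; rewrite addn0 h'0 muln1.
Qed.

End Strict.

(** * The groups G_A *)

Section Concrete.
Local Open Scope ring_scope.
Implicit Types (A : pred nat) (w : seq (option bool)) (d x : int).

(** Exchanges 0 and 1, and d and d + 1.  For d = 0 the second exchange is the
    first one, so that d = 0 encodes the absence of a further defect. *)
Definition swaps d x : int :=
  if x == 0 then 1 else if x == 1 then 0
  else if x == d then d + 1 else if x == d + 1 then d else x.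

(** [Some true] and [Some false] are the shift and its inverse. *)
Definition line_act d (s : option bool) x : int :=
  if s is Some b then (if b then x + 1 else x - 1) else swaps d x.

(** The two exchanges of [swaps] have disjoint supports when j is at least 2; a
    line with j < 2, as the line number 0, has no further defect. *)
Definition defect A (j : nat) : int := if A j && (1 < j)%N then j%:Z else 0.

Definition base_act A (s : option bool) (p : nat * int) : nat * int :=
  (p.1, line_act (defect A p.1) s p.2).

Definition base_inv (s : option bool) : option bool := omap negb s.

Lemma defectP A j : defect A j = 0 \/ [/\ defect A j = j%:Z, A j & (1 < j)%N].
Proof. by rewrite /defect; case: ifP => [/andP[]|]; [right|left]. Qed.

Lemma swapsK d : d = 0 \/ 2 <= d -> involutive (swaps d).
Proof.
move=> d2 x; rewrite {2}/swaps.
case: (x =P 0) => [->|x0]; first by rewrite /swaps.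
case: (x =P 1) => [->|x1]; first by rewrite /swaps.
by case: (x =P d) => xd; [|case: (x =P d + 1) => xd1]; rewrite /swaps;
  do ![case: eqP => ?]; lia.
Qed.

Lemma defect_ok A j : defect A j = 0 \/ 2 <= defect A j.
Proof. by case: (defectP A j) => [|[-> _]]; [left|right; lia]. Qed.

Lemma base_actK A s : cancel (base_act A s) (base_act A (base_inv s)).
Proof.
move=> [j x]; rewrite /base_act /=; congr (_, _).
case: s => [[]|] /=; rewrite ?addrK ?subrK //.
exact/swapsK/defect_ok.
Qed.

Lemma base_invK : involutive base_inv.
Proof. by case=> // -[]. Qed.

Lemma act_base_act A w j x :
  act_word (base_act A) w (j, x) = (j, act_word (line_act (defect A j)) w x).
Proof. by elim: w x => //= s w IH x; rewrite -IH. Qed.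

Lemma line_act_left d w x : 2 <= d -> x + (size w)%:Z < d ->
  act_word (line_act d) w x = act_word (line_act 0) w x.
Proof.
move=> d2; elim: w x => //= s w IH x xw.
have -> : line_act d s x = line_act 0 s x.
  by case: s => //=; rewrite /swaps; do ![case: eqP => ?]; lia.
apply: IH; case: s => [[]|] /=; rewrite ?/swaps; do ?[case: eqP => ?]; lia.
Qed.

Lemma line_act_right d w x : 2 <= d -> (size w)%:Z + 1 < x ->
  act_word (line_act d) w x = act_word (line_act 0) w (x - d) + d.
Proof.
move=> d2; elim: w x => /= [|s w IH] x xw; first by lia.
rewrite -/(act_word _ _ _) IH.
  rewrite -/(act_word _ _ _); congr (act_word _ _ _ + _).
  by case: s => [[]|] /=; rewrite ?/swaps; do ?[case: eqP => ?]; lia.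
by case: s => [[]|] /=; rewrite ?/swaps; do ?[case: eqP => ?]; lia.
Qed.

Definition base_trivial A := trivial_word (base_act A).

Lemma base_trivialP A w : reflect
  (forall j x, act_word (line_act (defect A j)) w x = x) (base_trivial A w).
Proof.
apply: (iffP (asboolP _)) => h => [j x|[j x]].
  by have := h (j, x); rewrite act_base_act => -[].
by rewrite act_base_act h.
Qed.

(** On the line with a far defect j, a short word sees at most one of the two
    exchanges: it acts as on the line without j at a point that it cannot move
    to j, and as on the translate by j of that line at all other points. *)
Lemma base_trivial_local A A' w :
  (forall j, A j -> A' j || (2 * size w + 5 <= j)%N) ->
  base_trivial A' w -> base_trivial A w.
Proof.
move=> AA' /base_trivialP w1; apply/base_trivialP => j x.
have w0 y : act_word (line_act 0) w y = y.
  by have := w1 0%N y; rewrite /defect andbF.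
have [->//|[dE Aj j1]] := defectP A j; rewrite dE.
case/orP: (AA' j Aj) => [A'j|jw].
  by have := w1 j x; rewrite /defect A'j j1.
have [xw|xw] := ltP (x + (size w)%:Z) j%:Z.
  by rewrite line_act_left //; lia.
by rewrite line_act_right ?w0; lia.
Qed.

(** The involution followed by its conjugate by the shift of n + 1, which
    exchanges n + 1 and n + 2 on a line without defect.  Both factors have
    order 2, so that [probe n ++ probe n] is their commutator. *)
Definition probe n : seq (option bool) :=
  None :: nseq n.+1 (Some false) ++ None :: nseq n.+1 (Some true).

Lemma act_nseq d b n x : act_word (line_act d) (nseq n (Some b)) x =
  if b then x + n%:Z else x - n%:Z.
Proof.
elim: n x => [|n IH] x /=; first by case: b; lia.
by rewrite -/(act_word _ _ _) IH; case: b {IH}; lia.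
Qed.

Lemma act_probe d n x : act_word (line_act d) (probe n) x =
  swaps d (swaps d x - n.+1%:Z) + n.+1%:Z.
Proof.
have -> : probe n = [:: None] ++ nseq n.+1 (Some false) ++
    [:: None] ++ nseq n.+1 (Some true) by [].
by rewrite !act_word_cat !act_nseq.
Qed.

(** The two involutions have disjoint supports as long as defects are below n. *)
Lemma probe_trivial A n : (0 < n)%N -> (forall j, A j -> (j < n)%N) ->
  base_trivial A (probe n ++ probe n).
Proof.
move=> n0 An; apply/base_trivialP => j x; set d := defect A j.
have dn : d = 0 \/ 2 <= d < n%:Z.
  by rewrite /d; case: (defectP A j) => [|[-> /An jn j1]]; [left|right; lia].
have dK := @swapsK d; pose g y := swaps d (y - n.+1%:Z) + n.+1%:Z.
have gK : involutive g by move=> y; rewrite /g addrK dK ?subrK //; lia.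
have g_id y : y < n.+1%:Z -> g y = y.
  by rewrite /g /swaps; do ![case: eqP => ?]; lia.
have fg y : swaps d y = y \/ (g y = y /\ g (swaps d y) = swaps d y).
  have [yn|yn] := ltP y n.+1%:Z; last first.
    by left; rewrite /swaps; do ![case: eqP => ?]; lia.
  right; rewrite !g_id //.
  by rewrite /swaps; do ![case: eqP => ?]; lia.
rewrite act_word_cat !act_probe -!/(g _).
case: (fg x) => [fx|[gx ->]]; last by rewrite dK ?gx //; lia.
rewrite fx.
case: (fg (g x)) => [->|[ggx _]]; first exact: gK.
by move: ggx; rewrite gK => gx; rewrite -gx fx -gx.
Qed.

(** With a defect at n, the supports meet at n + 1 and n is sent to n + 1. *)
Lemma probe_nontrivial A n : A n -> (1 < n)%N ->
  ~~ base_trivial A (probe n ++ probe n).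
Proof.
move=> An n1; apply/negP => /base_trivialP /(_ n n%:Z).
rewrite act_word_cat !act_probe /defect An n1 /=.
have -> : swaps n n = n%:Z + 1 by rewrite /swaps; do ![case: eqP => ?]; lia.
have -> : swaps n (n%:Z + 1 - n.+1%:Z) = 1 by rewrite (_ : _ - _ = 0) //; lia.
have -> : swaps n (1 + n.+1%:Z) = 1 + n.+1%:Z.
  by rewrite /swaps; do ![case: eqP => ?]; lia.
by rewrite addrK /swaps /=; lia.
Qed.

End Concrete.

(** * Counting self-avoiding walks in the free products *)

Section Counts.
Implicit Types (A : pred nat).

Definition base_count A := count_words (avoids (base_trivial A)).
Definition free_count A := count_words (avoids (free_relator (base_trivial A))).
Definition tail_count A := count_words
  (fun w => avoids (free_relator (base_trivial A)) (None :: w)).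

Lemma free_countE A n : free_count A n =
  base_count A n + \sum_(i < n) base_count A i * tail_count A (n.-1 - i).
Proof.
rewrite /free_count (@count_words_split _ _ (avoids (base_trivial A))
  (fun w => avoids (free_relator (base_trivial A)) (None :: w))); last first.
  by move=> u v; rewrite avoids_map_cat.
congr (_ + _); apply: eq_count_words => u; exact: avoids_map.
Qed.

Lemma tail_countE A n : tail_count A n =
  base_count A n + \sum_(i < n) inner_blocks (base_count A) i * tail_count A (n.-1 - i).
Proof.
rewrite /tail_count (@count_words_split _ _
  (fun u => (u != [::]) && avoids (base_trivial A) u)
  (fun w => avoids (free_relator (base_trivial A)) (None :: w))); last first.
  by move=> u v; rewrite avoids_None_map_cat.
congr (_ + _); first by apply: eq_count_words => u; apply: avoids_None_map.
by apply: eq_bigr => -[[|i] ilt] _; congr (_ * _).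
Qed.

Lemma base_count0 A : base_count A 0 = 1.
Proof. by []. Qed.

Lemma base_count1 A : 0 < base_count A 1.
Proof.
have := @ltn_count_words _ pred0 (avoids (base_trivial A)) [:: Some true].
rewrite count_words0; apply=> //.
rewrite /= /no_prefix /= orbF !andbT; apply/negP => /base_trivialP /(_ 0 0%R).
by [].
Qed.

Lemma tail_count_gt0 A n : 0 < tail_count A n.
Proof. exact: (renewal_gt0 (tail_countE A) _ (base_count1 A)). Qed.

Lemma tail_le_free A n : tail_count A n <= free_count A n.
Proof. by apply: leq_count_words => w _ /andP[]. Qed.

Lemma free_count_gt0 A n : 0 < free_count A n.
Proof. exact: leq_trans (tail_count_gt0 A n) (tail_le_free A n). Qed.

Lemma free_count_submult A m n :
  free_count A (m + n) <= free_count A m * free_count A n.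
Proof. by apply: count_words_submult => u v; apply: avoids_cat. Qed.

Lemma free_count_local A A' n : (forall j, A j -> A' j || (2 * n + 5 <= j)) ->
  free_count A n <= free_count A' n.
Proof.
move=> AA'; apply: leq_count_words => w wn; apply: sub_avoids => v vw.
case/orP => [vN|/andP[v1 v2]]; apply/orP; [by left|right]; rewrite v1.
apply: base_trivial_local v2 => j /AA' /orP[->//|jn]; apply/orP; right.
apply: leq_trans jn; rewrite leq_add2r leq_mul2l /= -wn.
by rewrite (leq_trans _ vw) // size_pmap count_size.
Qed.

Lemma base_count_lt A n : 1 < n -> (forall j, A j -> j < n) ->
  exists2 m, 0 < m &
    base_count A m < base_count (fun j => A j || (j == n)) m.
Proof.
move=> n1 An; set A' := fun j => A j || (j == n).
have A'n : A' n by rewrite /A' eqxx orbT.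
have sub u : base_trivial A' u -> base_trivial A u.
  by apply: base_trivial_local => j Aj; rewrite /A' Aj.
have [v [av nav v0]] := avoids_witness
  (fun u v r v1 => trivial_word_infix u r (sub v v1))
  (@trivial_word_infix _ _ (base_act A')) (trivial_word_nil _)
  (probe_trivial (ltnW n1) An) (probe_nontrivial A'n n1).
exists (size v); first by rewrite lt0n size_eq0.
apply: ltn_count_words => // w; apply: sub_avoids => u _.
exact: sub.
Qed.

Definition free_base_action A : inv_action (option (option bool)) _ :=
  @InvAction _ _ (free_act (base_act A)) (omap base_inv)
    (fun b => if b is Some s then congr1 Some (base_invK s) else erefl)
    (fun b => if b is Some s then free_act_SomeK (base_actK A s)
              else free_act_NoneK (base_act A)).

Variable R : realType.
Definition connective A : R := growth R (free_count A).

Lemma connective_cayley A : cayley_connective_constants R (connective A).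
Proof.
exists (word_group (free_base_action A)), (letters (free_base_action A)).
split; first exact: generating_letters.
have inj : injective (letter (free_base_action A)).
  (* At the point 5 of the line number 0 the four letters act differently. *)
  move=> b b' /word_elt_eq /(_ ((fun=> (0, 0%R)), ((0, 5%R), [::]))).
  move=> /(congr1 (fun p => (p.2.1.2, size p.2.2))).
  case: b b' => [[[]|]|] [[[]|]|] //;
    by rewrite /= /base_act /defect andbF.
move=> o; rewrite (_ : (fun n => _) = fun n => ((free_count A n)%:R `^ n%:R^-1)%R).
  apply: growth_cvg; [exact: free_count_gt0|exact: free_count_submult].
apply/funext => n; rewrite saw_count_letters //; congr (_%:R `^ _)%R.
apply: eq_count_words => w.
apply: (@avoids_free _ _ (base_act A) ((0, 0%R) : nat * int) w) => -[j x].
by exists (j, (x + 1)%R); apply/eqP => -[]; lia.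
Qed.

End Counts.

(** * A Cantor set of connective constants *)

Section Choice.
Variable R : realType.
Implicit Types (A : pred nat).
Local Open Scope ring_scope.
Local Notation mu := (connective R).

Lemma connective_le A A' : (forall j, A j -> A' j) -> mu A <= mu A'.
Proof.
move=> AA'; apply: growth_le => n; [exact: free_count_gt0..|].
by apply: free_count_local => j /AA' ->.
Qed.

Lemma connective_lt A n : (1 < n)%N -> (forall j, A j -> (j < n)%N) ->
  mu A < mu (fun j => A j || (j == n)).
Proof.
move=> n1 An; have [m m0 cm] := base_count_lt n1 An.
apply: (growth_lt R (tail_countE A) (free_countE A) (tail_countE _) _ _ _ _ _ _ _ m0 cm).
- by rewrite base_count0.
- exact: base_count1.
- exact: free_count_gt0.
- exact: free_count_submult.
- by [].
- exact: tail_le_free.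
- move=> k; apply: leq_count_words => w _; apply: sub_avoids => v _.
  by apply: base_trivial_local => j ->.
Qed.

Lemma connective_usc A (e : R) : 0 < e -> exists N, forall A',
  (forall j, A' j -> A j || (N <= j)%N) -> mu A' < mu A + e.
Proof.
move=> e0; have Ae : mu A < mu A + e by rewrite ltrDl.
have [n n0 hn] := growth_lt_exp Ae.
exists (2 * n + 5)%N => A' /free_count_local hA'.
have A'0 : 0 < mu A' by apply/growth_gt0/free_count_gt0.
have Ae0 : 0 <= mu A + e.
  by rewrite addr_ge0 ?ltW //; apply/growth_gt0/free_count_gt0.
rewrite -(@ltr_pXn2r _ n) ?nnegrE ?(ltW A'0) //.
apply: le_lt_trans hn; apply: le_trans (growth_exp_le R (free_count_gt0 A') n) _.
by rewrite ler_nat.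
Qed.

Definition below A n : pred nat := fun j => A j && (j < n)%N.
Definition with_tail A N : pred nat := fun j => A j || (N <= j)%N.

(** Later elements, taken from N on, cannot make up for the absence of n, and
    change mu by less than 1 / (n + 1). *)
Let separated A n N :=
  mu (with_tail (below A n) N) < mu (fun j => below A n j || (j == n)) /\
  mu (with_tail (below A n.+1) N) < mu (below A n.+1) + n.+1%:R^-1.

Let separated_mono A n M N : (M <= N)%N -> separated A n M -> separated A n N.
Proof.
move=> MN [s1 s2]; split; [move: s1|move: s2]; apply: le_lt_trans;
  apply: connective_le => j; rewrite /with_tail => /orP[->//|Nj];
  by rewrite (leq_trans MN Nj) orbT.
Qed.

Let separated_below A n N : separated (below A n.+1) n N -> separated A n N.
Proof.
rewrite /separated (_ : below (below A n.+1) n = below A n); last first.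
  by apply/funext => j; rewrite /below; case: (A j) => //=; lia.
rewrite (_ : below (below A n.+1) n.+1 = below A n.+1) //.
by apply/funext => j; rewrite /below; case: (A j) => //=; lia.
Qed.

(** The bound N is uniform in A because [separated] only depends on A up to n,
    which leaves finitely many cases. *)
Lemma exists_next n : exists N, (1 < n)%N -> (n < N)%N /\ forall A, separated A n N.
Proof.
have [n1|n1] := ltnP 1 n; last by exists 0%N.
have sepA A : exists N, separated A n N.
  have lt1 : mu (below A n) < mu (fun j => below A n j || (j == n)).
    by apply: connective_lt => // j /andP[].
  move: (lt1); rewrite -subr_gt0 => /(connective_usc (below A n)) [N1 hN1].
  have n0 : 0 < n.+1%:R^-1 :> R by rewrite invr_gt0.
  have [N2 hN2] := connective_usc (below A n.+1) n0.
  exists (maxn N1 N2); split.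
    have := hN1 (with_tail (below A n) (maxn N1 N2)); rewrite addrC subrK; apply.
    by move=> j; rewrite /with_tail geq_max => /orP[->|/andP[-> _]]; rewrite ?orbT.
  apply: hN2 => j; rewrite /with_tail geq_max => /orP[->|/andP[_ ->]] //.
  by rewrite orbT.
pose ofset (S : {set 'I_n.+1}) : pred nat := fun j => [exists i in S, i == j :> nat].
have [N hN] := choice (fun S => sepA (ofset S)).
exists (maxn n.+1 (\max_S N S)) => _; split; first exact: leq_maxl.
move=> A; apply: separated_below.
pose S := [set i : 'I_n.+1 | A i]%SET.
have -> : below A n.+1 = ofset S.
  apply/funext => j; apply/andP/existsP => [[Aj jn]|[i]].
    by exists (Ordinal jn); rewrite inE Aj /=.
  by rewrite inE => /andP[Ai /eqP <-].
apply: separated_mono (hN S); rewrite leq_max; apply/orP; right.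
exact: (leq_bigmax S).
Qed.

Lemma exists_scale : exists nu : nat -> nat, forall k,
  [/\ (1 < nu k)%N, (nu k < nu k.+1)%N & forall A, separated A (nu k) (nu k.+1)].
Proof.
have [next nextP] := choice exists_next.
exists (fun k => iter k next 2) => k.
suff nu1 : (1 < iter k next 2)%N by have [] := nextP _ nu1.
by elim: k => //= k IH; have [kn _] := nextP _ IH; apply: ltn_trans IH kn.
Qed.

Definition scale := projT1 (cid exists_scale).
Local Notation nu := scale.

Let nu_gt1 k : (1 < nu k)%N.
Proof. by have [] := projT2 (cid exists_scale) k. Qed.

Let nu_ltS k : (nu k < nu k.+1)%N.
Proof. by have [] := projT2 (cid exists_scale) k. Qed.

Let nu_separated A k : separated A (nu k) (nu k.+1).
Proof. by have [] := projT2 (cid exists_scale) k. Qed.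

Let nu_lt : {mono nu : i j / (i < j)%N}.
Proof. exact: leqW_mono (leq_mono (homo_ltn ltn_trans nu_ltS)). Qed.

Let nu_ge k : (k <= nu k)%N.
Proof. by elim: k => // k IH; apply: leq_ltn_trans IH (nu_ltS k). Qed.

Definition coded (b : nat -> bool) : pred nat :=
  fun j => `[< exists2 k, nu k = j & b k >].

Lemma coded_nu b k : coded b (nu k) = b k.
Proof.
apply/asboolP/idP => [[i nuik]|bk]; last by exists k.
suff -> : i = k by [].
by have := nu_lt i k; have := nu_lt k i; rewrite nuik !ltnn; lia.
Qed.

Definition embedding (b : nat -> bool) : R := mu (coded b).

Let sub_tail b b' k : (forall i, (i <= k)%N -> b i = b' i) ->
  forall j, coded b' j -> with_tail (below (coded b) (nu k).+1) (nu k.+1) j.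
Proof.
move=> bb' j /asboolP [i <- b'i]; rewrite /with_tail /below coded_nu.
have [ik|ki] := leqP i k.
  by rewrite bb' // b'i ltnS leqNgt nu_lt -leqNgt ik.
by rewrite [(nu k.+1 <= _)%N]leqNgt nu_lt -leqNgt ki orbT.
Qed.

(** Both values lie between mu of the part of the set up to nu k and that value
    plus 1 / (nu k + 1). *)
Lemma embedding_close b b' k : (forall i, (i <= k)%N -> b i = b' i) ->
  embedding b' < embedding b + (nu k).+1%:R^-1.
Proof.
move=> bb'; have [_ sep] := nu_separated (coded b) k.
apply: (le_lt_trans (connective_le (sub_tail bb'))).
apply: (lt_le_trans sep); rewrite lerD2r; apply: connective_le => j.
by case/andP.
Qed.

(** Strict monotonicity for the lexicographic order. *)
Lemma embedding_lt b b' k : (forall i, (i < k)%N -> b i = b' i) ->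
  ~~ b k -> b' k -> embedding b < embedding b'.
Proof.
move=> bb' nbk b'k; have [sep _] := nu_separated (coded b) k.
have blw j : below (coded b) (nu k).+1 j -> below (coded b) (nu k) j.
  move=> /andP[bj]; rewrite /below bj ltnS leq_eqVlt => /orP[/eqP jE|//].
  by move: bj; rewrite jE coded_nu (negbTE nbk).
apply: (@le_lt_trans _ _ (mu (with_tail (below (coded b) (nu k)) (nu k.+1)))).
  apply: connective_le => j /(@sub_tail b b k (fun _ _ => erefl)).
  by case/orP => [/blw|] h; rewrite /with_tail h ?orbT.
apply: (lt_le_trans sep); apply: connective_le => j /orP[/andP[]|/eqP ->].
  move=> /asboolP [i <- bi]; rewrite nu_lt => ik.
  by rewrite coded_nu -bb'.
by rewrite coded_nu.
Qed.

Lemma embedding_inj : injective embedding.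
Proof.
move=> b b' bb'; apply/funext => k; have [n] := ubnP k.
elim: n k => // n IH k kn.
have agree i : (i < k)%N -> b i = b' i by move=> ik; apply: IH; lia.
case bk: (b k); case b'k: (b' k) => //.
  have := @embedding_lt b' b k; rewrite bb' ltxx bk b'k => h.
  by rewrite h // => i ik; rewrite agree.
by have := embedding_lt agree; rewrite bb' ltxx bk b'k => ->.
Qed.

Lemma near_agree (b : cantor_space) k :
  nbhs b [set b' : cantor_space | forall i, (i < k)%N -> b i = b' i].
Proof.
elim: k => [|k IH].
  apply: (@filterS _ (nbhs b) _ setT _ _ filterT) => b' _ i.
  by rewrite ltn0.
have Hk : nbhs b [set b' : cantor_space | b k = b' k].
  have := @proj_continuous nat (fun=> bool) k b.
  move=> /(_ [set x | b k = x]) /=; apply.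
  by apply: (@filterS _ (nbhs (b k)) _ [set b k] _ _ (discrete_set1 _)) => x ->.
apply: filterS2 IH Hk => b' IHb b'k i; rewrite ltnS leq_eqVlt => /orP[/eqP ->//|].
exact: IHb.
Qed.

Lemma embedding_continuous : continuous (embedding : cantor_space -> R).
Proof.
move=> b; apply/cvgrPdist_lt => e e0.
pose k := Num.bound e^-1.
have ke : (nu k).+1%:R^-1 < e.
  rewrite invf_plt ?posrE //.
  apply: lt_le_trans (archi_boundP _) _; first by rewrite invr_ge0 ltW.
  by rewrite ler_nat leqW.
apply: filterS (near_agree b k.+1) => b' bb'.
have bb'' i : (i <= k)%N -> b' i = b i by move=> ik; rewrite bb'.
have := embedding_close bb'; have := embedding_close bb''.
move: (_^-1) (embedding b) (embedding b') ke => d u v ke uv vu.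
by rewrite ltr_norml; apply/andP; split; lra.
Qed.
End Choice.

(** A closed set of the source is compact, hence has a closed image. *)
Lemma homeomorphic_range (T U : topologicalType) (f : T -> U) :
  compact [set: T] -> hausdorff_space U -> continuous f -> injective f ->
  homeomorphic (set_type (range f)) T.
Proof.
move=> cptT hU fc finj.
have frange t : f t \in range f by apply/mem_set; exists t.
pose F (t : T) : set_type (range f) := exist _ (f t) (frange t).
have rangeP (u : set_type (range f)) : {t | f t = val u}.
  by apply: cid; case: u => u /= /set_mem [t _ <-]; exists t.
pose G (u : set_type (range f)) : T := sval (rangeP u).
have fG u : f (G u) = val u by exact: svalP (rangeP u).
exists G, F; split.
- apply/continuous_closedP => C cC.
  have -> : G @^-1` C = set_val @^-1` (f @` C).
    apply/seteqP; split=> [u Cu|u [t Ct tu]] /=; first by exists (G u).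
    by have /finj -> : f (G u) = f t by rewrite fG tu.
  move/continuous_closedP: (@initial_continuous _ _ (@set_val _ (range f))); apply.
  apply: compact_closed => //; apply: continuous_compact.
    exact: continuous_subspaceT.
  exact: subclosed_compact cC cptT _.
- exact: (@continuous_comp_initial _ _ _ set_val).
- by move=> u; apply/val_inj; rewrite /= fG.
- by move=> t; apply: finj; rewrite fG.
Qed.

(** A real number is determined by the set of rationals below it. *)
Lemma card_le_real (R : realType) (A : set R) : A #<= [set: nat -> bool].
Proof.
pose cut (x : R) (n : nat) : bool :=
  if (choice.unpickle n : option rat) is Some q then (ratr q < x)%R else false.
apply/pcard_injP; exists cut => x y _ _ xy.
have cut_lt u v : cut u = cut v -> ~ (u < v)%R.
  move=> uv /rat_in_itvoo [q]; rewrite in_itv /= => /andP[uq qv].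
  have := congr1 (fun g => g (choice.pickle q)) uv; rewrite /cut /= choice.pickleK qv.
  by rewrite ltNge (ltW uq).
apply/eqP; rewrite eq_le !leNgt; apply/andP; split; apply/negP.
  exact: cut_lt (esym xy).
exact: cut_lt xy.
Qed.

Theorem mainTheorem1 (R : realType) :
  (exists K : set R,
     K `<=` cayley_connective_constants R /\
     homeomorphic (set_type K) cantor_space) /\
  cayley_connective_constants R #= [set: nat -> bool].
Proof.
split.
  exists (range (@embedding R)); split; last first.
    apply: (@homeomorphic_range cantor_space R).
    - exact: cantor_space_compact.
    - exact: Rhausdorff.
    - exact: embedding_continuous.
    - exact: embedding_inj.
  by move=> _ [b _ <-]; apply: connective_cayley.
rewrite card_eq_le card_le_real /=.
have: range (@embedding R) #= [set: nat -> bool].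
  by apply: inj_card_eq => b b' _ _; apply: embedding_inj.
rewrite card_eq_le => /andP[_ /card_le_trans]; apply; apply: subset_card_le.
by move=> _ [b _ <-]; apply: connective_cayley.
Qed.
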